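(* Consider the following algorithm (first-visit Monte Carlo policy evaluation with $H$-step lookahead). Fix integers $m\ge1$, $H\ge1$, an initial vector $V_0\in\mathbb{R}^{|\mathcal S|}$, and deterministic stepsizes $\gamma_k\in(0,1]$. At iteration $k\ge0$: let $\mu_{k+1}$ be a policy with $T_{\mu_{k+1}}T^{H-1}V_k=T^HV_k$; generate one trajectory of the Markov chain under $\mu_{k+1}$ whose initial state is drawn from a distribution $p$ on $\mathcal S$; let $\mathcal D_k$ be the set of states visited by the trajectory; for each $i\in\mathcal D_k$ obtain, from the portion of the trajectory starting at the first visit to $i$, an estimate $T^m_{\mu_{k+1}}T^{H-1}V_k(i)+w_k(i)$; and set $$V_{k+1}(i)=\begin{cases}(1-\gamma_k)V_k(i)+\gamma_k\big(T^m_{\mu_{k+1}}T^{H-1}V_k(i)+w_k(i)\big), & i\in\mathcal D_k,\\ V_k(i), & i\notin\mathcal D_k.\end{cases}$$ Assume: (a) $p(i)>0$ for all $i\in\mathcal S$; (b) $\alpha^{H-1}+2(1+\alpha^m)\frac{\alpha^{H-1}}{1-\alpha}<1$; (c) $\sum_k\gamma_k=\infty$ and $\sum_k\gamma_k^2<\infty$; and the noise satisfies $E[w_k(i)\mid\mathcal F_k, i\in\mathcal D_k]=0$ and $|w_k(i)|\le C$ almost surely for a constant $C$, where $\mathcal F_k$ is the history up to the start of iteration $k$. Then $V_k\to J^*$ almost surely.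
   Context: Finite Markov decision process with finite state space $\mathcal S$, finite action set $\mathcal A$, transition probabilities $P_{ij}(u)$, costs $g(i,u)\in[0,1]$, discount $\alpha\in(0,1)$. For a policy $\mu:\mathcal S\to\mathcal A$, $T_\mu J=g_\mu+\alpha P_\mu J$ with $g_\mu(i)=g(i,\mu(i))$, $(P_\mu)_{ij}=P_{ij}(\mu(i))$; $T^m_\mu$ is the $m$-fold composition (an $m$-step rollout). $(TJ)(i)=\min_u\big[g(i,u)+\alpha\sum_jP_{ij}(u)J(j)\big]$ with fixed point $J^*$ (the optimal value function). The quantity $T^m_{\mu_{k+1}}T^{H-1}V_k(i)+w_k(i)$ is a sampled return whose conditional mean is $T^m_{\mu_{k+1}}T^{H-1}V_k(i)$. *)

(* Defs.v *)
From HB Require Import structures.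
From mathcomp Require Import all_boot all_order all_algebra.
From mathcomp Require Import all_classical all_reals all_analysis.
Set Implicit Arguments. Unset Strict Implicit. Unset Printing Implicit Defensive.
Import Order.TTheory GRing.Theory Num.Theory.
Local Open Scope ring_scope.
Local Open Scope classical_set_scope.

Section MDP.
Variables (R : realType) (S A : finType).

Definition Tmu (alpha : R) (g : S -> A -> R) (Pt : S -> A -> S -> R)
  (mu : S -> A) (J : S -> R) : S -> R :=
  fun i => g i (mu i) + alpha * \sum_(j : S) Pt i (mu i) j * J j.

(* (T J)(i) = min_u [ g(i,u) + alpha sum_j P_ij(u) J(j) ];
   a0 is any action, used only as the seed of the finite minimum
   (the value does not depend on it). *)
Definition Topt (a0 : A) (alpha : R) (g : S -> A -> R) (Pt : S -> A -> S -> R)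
  (J : S -> R) : S -> R :=
  fun i => \big[Order.min/ g i a0 + alpha * \sum_(j : S) Pt i a0 j * J j]_(u : A)
             (g i u + alpha * \sum_(j : S) Pt i u j * J j).

Definition visited (X : nat -> S) (L : nat) : {set S} :=
  [set s | [exists t : 'I_L.+1, X t == s]].
End MDP.

Definition Fmeas {T : Type} {R : realType} (G : set (set T)) (f : T -> R) :=
  forall r : R, G [set x | f x <= r].

(* Main.v *)
Require Import Defs.
From HB Require Import structures.
From mathcomp Require Import all_boot all_order all_algebra.
From mathcomp Require Import all_classical all_reals all_analysis.
From mathcomp Require Import measurable_realfun ring lra.
Set Implicit Arguments.
Unset Strict Implicit.
Unset Printing Implicit Defensive.
Import Order.TTheory GRing.Theory Num.Theory.
Import numFieldNormedType.Exports.
Local Open Scope ring_scope.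
Local Open Scope classical_set_scope.

(** With [J = T^{H-1} V] and [mu] greedy, [T_mu^m J - J] telescopes into
    [T_mu^{t+1} J - T_mu^t J], and [T_mu J - J = T J - J] is at most
    [2 alpha^{H-1} |V - J*|]; hence condition (b) makes [V |-> T_mu^m T^{H-1} V]
    contract towards [J*], although [mu] depends on [V].

    Two series converge almost surely, being square-integrable martingales: the
    weighted noise [sum gamma_k 1{i in D_k} w_k(i)] and the recentred visit counts
    [sum gamma_k (1{X_k(0) = i} - p(i))].  The second one gives
    [sum gamma_k 1{i in D_k} = +oo].  From there on the argument is pathwise:
    adding the tail of the noise series to [V_k - J*] turns the algorithm into a
    noiseless asynchronous averaging of targets that are contracting up to a
    vanishing error. *)

(** * Asynchronous averaging *)

Section AsynchronousAveraging.
Variable R : realType.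

(** Since [(1 - a) (1 + s + a) = 1 + s - a (s + a)], the product [z n * (1 + s)] cannot grow while
    [z] is positive, and once [z] is nonpositive it stays so. Divergence of the sum of the [a k]
    thus pushes the positive part of [z] to 0 at an explicit rate. *)
Lemma relaxation_decay (a z : nat -> R) (D : R) : 0 <= D ->
  (forall k, 0 <= a k <= 1) -> (forall k, z k.+1 <= (1 - a k) * z k) ->
  z 0%N <= D -> forall n, z n * (1 + \sum_(k < n) a k) <= D.
Proof.
move=> D0 a01 zS z0; elim=> [|n IH]; first by rewrite big_ord0 addr0 mulr1.
have s0 : 0 <= \sum_(k < n) a k by apply: sumr_ge0 => k _; case/andP: (a01 k).
rewrite big_ord_recr /=; set s := \sum_(k < n) a k in s0 IH *.
have /andP[an0 an1] := a01 n; have zn := zS n.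
have [zneg|zpos] := leP (z n) 0.
  have z1 : z n.+1 <= 0 by apply: le_trans zn _; rewrite mulr_ge0_le0 ?subr_ge0.
  by apply: le_trans D0; rewrite mulr_le0_ge0// addr_ge0// addr_ge0.
apply: le_trans IH; apply: (@le_trans _ _ ((1 - a n) * z n * (1 + (s + a n)))).
  by apply: ler_wpM2r => //; rewrite addr_ge0// addr_ge0.
rewrite -subr_ge0 (_ : _ - _ = z n * (a n * (s + a n))); last by ring.
by rewrite mulr_ge0 ?(ltW zpos)// mulr_ge0// addr_ge0.
Qed.

Lemma sum_shift_cvgy (a : nat -> R) (N : nat) :
  (fun n => \sum_(k < n) a k) @ \oo --> +oo ->
  (fun n => \sum_(k < n) a (N + k)%N) @ \oo --> +oo.
Proof.
move=> /cvgryPge ay; apply/cvgryPge => M.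
have [n0 _ Hn] := ay (M + \sum_(k < N) a k).
exists n0 => // n /= n0n.
have := Hn (N + n)%N (leq_trans n0n (leq_addl _ _)).
by rewrite /= big_split_ord /= addrC lerD2r.
Qed.

Variables (S : finType) (a y h : nat -> S -> R) (rho : nat -> R) (b : R).
Hypothesis b01 : 0 <= b < 1.
Hypothesis a01 : forall k i, 0 <= a k i <= 1.
Hypothesis a_div : forall i, (fun n => \sum_(k < n) a k i) @ \oo --> +oo.
Hypothesis rho0 : rho @ \oo --> (0 : R).
Hypothesis yS : forall k i, y k.+1 i = (1 - a k i) * y k i + a k i * h k i.
(** A sup-norm contraction up to the error [rho k], quantified over all upper bounds [D] so that no
    maximum over [S] has to be formed. *)
Hypothesis h_le : forall k D, (forall i, `|y k i| <= D) ->
  forall i, `|h k i| <= b * D + rho k.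

Lemma averaging_step_le k i (B D : R) : `|y k i| <= B -> `|h k i| <= D ->
  `|y k.+1 i| <= (1 - a k i) * B + a k i * D.
Proof.
move=> yB hD; rewrite yS; have /andP[a0 a1] := a01 k i.
apply: le_trans (ler_normD _ _) _; rewrite !normrM (ger0_norm a0) ger0_norm ?subr_ge0//.
by apply: lerD; apply: ler_wpM2l => //; rewrite subr_ge0.
Qed.

Lemma averaging_bounded : exists2 D, 0 < D & forall k i, `|y k i| <= D.
Proof.
have [M Mrho] : exists M, forall k, rho k <= M.
  have /cvg_seq_bounded[M [_ HM]] : cvg (rho @ \oo) by apply/cvg_ex; exists 0.
  exists (M + 1) => k; apply: le_trans (ler_norm _) _.
  by apply: HM => //; rewrite ltrDl.
have /andP[b0 b1] := b01.
(* The term [|M| / (1 - b)] gives [b * D + M <= D], which makes the ball of radius [D] invariant;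
   the sum covers the initial vector and the 1 keeps [D] positive. *)
pose D := \sum_i `|y 0%N i| + `|M| / (1 - b) + 1.
have b1' : 0 < 1 - b by rewrite subr_gt0.
have s0 : 0 <= \sum_i `|y 0%N i| by apply: sumr_ge0.
have q0 : 0 <= `|M| / (1 - b) by rewrite divr_ge0// ltW.
have D0 : 0 < D by rewrite /D; lra.
have bD : b * D + M <= D.
  rewrite -subr_ge0 (_ : _ - _ = (1 - b) * D - M); last by ring.
  rewrite subr_ge0 (le_trans (ler_norm _))// mulrC -ler_pdivrMr//.
  by rewrite /D; lra.
exists D => //; elim=> [i|k IH i].
  rewrite /D (bigD1 i) //=.
  have : 0 <= \sum_(j | j != i) `|y 0%N j| by apply: sumr_ge0.
  lra.
apply: le_trans (averaging_step_le (IH i) (h_le IH i)) _.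
have /andP[a0 a1] := a01 k i; have := Mrho k.
nra.
Qed.

(** Once [rho k] is below [(1 - b) / 4 * D], every target has size at most [c]. The excess of [|y|]
    over [c] is relaxed towards 0 and ends below another [(1 - b) / 4 * D]; the two quarters added
    to [b * D] make [(1 + b) / 2 * D]. *)
Lemma averaging_contract (D : R) : 0 < D ->
  (\forall k \near \oo, forall i, `|y k i| <= D) ->
  \forall k \near \oo, forall i, `|y k i| <= (1 + b) / 2 * D.
Proof.
move=> D0 yD; have /andP[b0 b1] := b01.
pose c := (b + (1 - b) / 4) * D.
have rhoD : \forall k \near \oo, rho k <= (1 - b) / 4 * D.
  have e0 : 0 < (1 - b) / 4 * D by rewrite mulr_gt0//; lra.
  move/cvgrPdist_le : rho0 => /(_ _ e0); apply: filterS => k.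
  by rewrite sub0r normrN => /(le_trans (ler_norm _)).
have [N _ HN] : \forall k \near \oo, (forall i, `|y k i| <= D) /\ rho k <= (1 - b) / 4 * D.
  by near=> k; split; near: k.
apply: filter_forall => i.
pose z n := `|y (N + n)%N i| - c.
have zS n : z n.+1 <= (1 - a (N + n)%N i) * z n.
  have [yn rn] := HN (N + n)%N (leq_addr _ _).
  have hn : `|h (N + n)%N i| <= c.
    by apply: le_trans (h_le yn i) _; rewrite /c; lra.
  have := averaging_step_le (lexx _) hn.
  rewrite /z addnS; lra.
have c0 : 0 <= c by rewrite /c mulr_ge0 ?(ltW D0)//; lra.
have z0 : z 0%N <= D.
  have [yn _] := HN (N + 0)%N (leq_addr _ _).
  by have := yn i; rewrite /z; lra.
have zn := @relaxation_decay (fun k => a (N + k)%N i) z D (ltW D0) (fun k => a01 _ i) zS z0.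
(* When the sum of the stepsizes exceeds [4 / (1 - b)], [relaxation_decay] bounds a positive excess
   by [D] divided by that number. *)
have /cvgryPge /(_ (4 / (1 - b))) [n0 _ Hn0] := @sum_shift_cvgy (a ^~ i) N (a_div i).
exists (N + n0)%N => // k /= Nk.
have Nk' : (N <= k)%N by apply: leq_trans Nk; exact: leq_addr.
rewrite -(subnKC Nk'); set n := (k - N)%N.
have {}Hn0 := Hn0 n; have {}zn := zn n.
have /Hn0 /= sn : (n0 <= n)%N by rewrite /n leq_subRL.
have b1' : 0 < 1 - b by rewrite subr_gt0.
have : z n <= (1 - b) / 4 * D.
  have [zneg|zpos] := leP (z n) 0.
    by apply: le_trans zneg _; rewrite mulr_ge0 ?(ltW D0)//; lra.
  have : z n * (4 / (1 - b)) <= D.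
    apply: le_trans zn; apply: ler_wpM2l; first exact: ltW.
    by apply: le_trans sn _; rewrite lerDr.
  rewrite mulrA ler_pdivrMr//; lra.
rewrite /z /c; lra.
Unshelve. all: by end_near. Qed.

Lemma averaging_cvg0 i : (fun k => y k i) @ \oo --> (0 : R).
Proof.
have [D D0 yD] := averaging_bounded; have /andP[b0 b1] := b01.
pose q := (1 + b) / 2; have q0 : 0 < q by rewrite /q; lra.
have q1 : q < 1 by rewrite /q; lra.
have ev n : \forall k \near \oo, forall i, `|y k i| <= q ^+ n * D.
  elim: n => [|n IH]; first by apply: nearW => k j; rewrite expr0 mul1r.
  have := averaging_contract (mulr_gt0 (exprn_gt0 _ q0) D0) IH.
  by rewrite -/q mulrA -exprS.
apply/cvgrPdist_le => e e0.
have [n Hn] : exists n, q ^+ n * D <= e.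
  have : (fun n => q ^+ n) @ \oo --> (0 : R) by apply: cvg_expr; rewrite gtr0_norm.
  move/cvgrPdist_le => /(_ (e / D)) []; first exact: divr_gt0.
  move=> n _ /(_ n (leqnn _)) /=; rewrite sub0r normrN gtr0_norm ?exprn_gt0//.
  by rewrite ler_pdivlMr// => ?; exists n.
apply: filterS (ev n) => k /(_ i) yk.
by rewrite sub0r normrN (le_trans yk).
Qed.

End AsynchronousAveraging.

Section StochasticApproximation.
Variables (R : realType) (S : finType).

(* The noise is absorbed by the substitution [y k = x k + r k], where [r k] is
   the tail of the convergent series of perturbations. *)
Lemma perturbed_averaging_cvg0 (a x h xi : nat -> S -> R) (b : R) :
  0 <= b < 1 -> (forall k i, 0 <= a k i <= 1) ->
  (forall i, (fun n => \sum_(k < n) a k i) @ \oo --> +oo) ->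
  (forall i, cvg ((fun n => \sum_(k < n) xi k i) @ \oo)) ->
  (forall k i, x k.+1 i = (1 - a k i) * x k i + a k i * h k i + xi k i) ->
  (forall k D, (forall i, `|x k i| <= D) -> forall i, `|h k i| <= b * D) ->
  forall i, (fun k => x k i) @ \oo --> (0 : R).
Proof.
move=> b01 a01 a_div xi_cvg xS h_le i.
pose s k i := \sum_(j < k) xi j i.
pose r k i := lim (s ^~ i @ \oo) - s k i.
(* As [r k.+1 = r k - xi k], the perturbation cancels in the recursion for [x + r], whose target is
   [h + r]. Passing from a bound on [x + r] to one on [x] costs [b] times the sum, and the summand
   [r] in the target costs one more. *)
pose rho k := (1 + b) * \sum_i `|r k i|.
have r0 j : (fun k => r k j) @ \oo --> (0 : R).
  by rewrite -(subrr (lim (s ^~ j @ \oo))); apply: cvgB; [exact: cvg_cst|exact: xi_cvg].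
have rho0 : rho @ \oo --> (0 : R).
  rewrite -(mulr0 (1 + b)); apply: cvgMr.
  rewrite [X in _ --> X](_ : _ = \sum_(j : S) `|0 : R|); last first.
    by rewrite big1// => j _; rewrite normr0.
  apply: cvg_big => [|j _]; first exact: add_continuous.
  exact: cvg_norm.
have /andP[b0 b1] := b01.
have r_le k j : `|r k j| <= \sum_i `|r k i|.
  by rewrite (bigD1 j)//= lerDl sumr_ge0.
have y0 := @averaging_cvg0 R S a (fun k i => x k i + r k i)
  (fun k i => h k i + r k i) rho b b01 a01 a_div rho0.
rewrite (_ : (fun k => x k i) = (fun k => (x k i + r k i) - r k i)); last first.
  by apply/funext => k; rewrite addrK.
rewrite -(subr0 (0 : R)); apply: cvgB => //; apply: y0 => [k j|k D yD j].
  rewrite xS /r /s big_ord_recr /=; ring.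
have hj : `|h k j| <= b * (D + \sum_i `|r k i|).
  apply: h_le => l; rewrite -[x k l](addrK (r k l)).
  by apply: le_trans (ler_normB _ _) _; apply: lerD.
apply: le_trans (ler_normD _ _) _.
have := r_le k j; rewrite /rho; lra.
Qed.

End StochasticApproximation.

(** * Bellman operators *)

Section Contraction.
Variables (R : realType) (S A : finType) (a0 : A) (alpha : R).
Variables (g : S -> A -> R) (Pt : S -> A -> S -> R).
Hypothesis alpha01 : 0 < alpha < 1.
Hypothesis Pt_ge0 : forall i u j, 0 <= Pt i u j.
Hypothesis Pt_sum1 : forall i u, \sum_(j : S) Pt i u j = 1.

Let Q (J : S -> R) i u := g i u + alpha * \sum_(j : S) Pt i u j * J j.

Lemma action_value_contract (J J' : S -> R) (D : R) i u :
  (forall j, `|J j - J' j| <= D) -> `|Q J i u - Q J' i u| <= alpha * D.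
Proof.
move=> JD; have /andP[al0 _] := alpha01.
rewrite /Q opprD addrACA subrr add0r -mulrBr normrM gtr0_norm//.
apply: ler_wpM2l; first exact: ltW.
rewrite -sumrB; apply: le_trans (ler_norm_sum _ _ _) _.
rewrite -[D]mul1r -(Pt_sum1 i u) mulr_suml; apply: ler_sum => j _.
by rewrite -mulrBr normrM ger0_norm// ler_wpM2l.
Qed.

Lemma Tmu_contract (mu : S -> A) (J J' : S -> R) (D : R) :
  (forall j, `|J j - J' j| <= D) ->
  forall i, `|Tmu alpha g Pt mu J i - Tmu alpha g Pt mu J' i| <= alpha * D.
Proof. by move=> JD i; apply: action_value_contract. Qed.

Lemma ler_dist_min (a b c e D : R) : `|a - b| <= D -> `|c - e| <= D ->
  `|Order.min a c - Order.min b e| <= D.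
Proof.
rewrite !ler_norml => /andP[? ?] /andP[? ?].
by apply/andP; case: (leP a c) => ?; case: (leP b e) => ?; split; lra.
Qed.

(** The minimum is nonexpansive, so the bound for each single action, the seed [a0] included, passes
    to the whole big minimum. *)
Lemma Topt_contract (J J' : S -> R) (D : R) :
  (forall j, `|J j - J' j| <= D) ->
  forall i, `|Topt a0 alpha g Pt J i - Topt a0 alpha g Pt J' i| <= alpha * D.
Proof.
move=> JD i; rewrite /Topt.
apply: (big_ind2 (fun x y => `|x - y| <= alpha * D)).
- exact: (action_value_contract i a0 JD).
- by move=> x1 x2 y1 y2; exact: ler_dist_min.
- by move=> u _; exact: (action_value_contract i u JD).
Qed.

Lemma iter_Topt_contract n (J J' : S -> R) (D : R) :
  (forall j, `|J j - J' j| <= D) ->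
  forall i, `|iter n (Topt a0 alpha g Pt) J i - iter n (Topt a0 alpha g Pt) J' i|
    <= alpha ^+ n * D.
Proof.
move=> JD; elim: n => [|n IH] i; first by rewrite expr0 mul1r.
by rewrite exprS -mulrA; exact: Topt_contract.
Qed.

(** Successive iterates differ by at most [alpha ^+ k * E], and these bounds form a geometric sum.
    Clearing the denominator [1 - alpha] keeps the induction polynomial. *)
Lemma iter_Tmu_drift (mu : S -> A) n (J : S -> R) (E : R) : 0 <= E ->
  (forall j, `|Tmu alpha g Pt mu J j - J j| <= E) ->
  forall i, (1 - alpha) * `|iter n (Tmu alpha g Pt mu) J i - J i| <= (1 - alpha ^+ n) * E.
Proof.
move=> E0 JE; have /andP[al0 al1] := alpha01.
have step k i : `|iter k.+1 (Tmu alpha g Pt mu) J i - iter k (Tmu alpha g Pt mu) J i|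
    <= alpha ^+ k * E.
  elim: k i => [|k IH] i; first by rewrite expr0 mul1r; exact: JE.
  by rewrite exprS -mulrA; exact: Tmu_contract.
elim: n => [|n IH] i; first by rewrite /= !subrr normr0 mulr0 mul0r.
have := step n i; have := IH i.
set T1 := iter n.+1 _ _ i; set T0 := iter n _ _ i => H0 H1.
have H2 : `|T1 - J i| <= `|T1 - T0| + `|T0 - J i|.
  by rewrite -[T1 - J i](subrKA T0); exact: ler_normD.
rewrite exprS; nra.
Qed.

Lemma lookahead_rollout_contract (mu : S -> A) (m n : nat) (V Jstar : S -> R) (D : R) :
  Topt a0 alpha g Pt Jstar = Jstar ->
  Tmu alpha g Pt mu (iter n (Topt a0 alpha g Pt) V)
    = iter n.+1 (Topt a0 alpha g Pt) V ->
  (forall j, `|V j - Jstar j| <= D) ->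
  forall i, `|iter m (Tmu alpha g Pt mu) (iter n (Topt a0 alpha g Pt) V) i - Jstar i|
    <= (alpha ^+ n + 2 * (1 + alpha ^+ m) * (alpha ^+ n / (1 - alpha))) * D.
Proof.
move=> Jfix greedy VD i; have /andP[al0 al1] := alpha01.
have D0 : 0 <= D by apply: le_trans (VD i).
set J := iter n (Topt a0 alpha g Pt) V in greedy *.
have Jn k : iter k (Topt a0 alpha g Pt) Jstar = Jstar.
  by elim: k => //= k ->.
have JD k j : `|iter k (Topt a0 alpha g Pt) V j - Jstar j| <= alpha ^+ k * D.
  by rewrite -{1}(Jn k); exact: iter_Topt_contract.
have aD : 0 <= alpha ^+ n * D by rewrite mulr_ge0// exprn_ge0// ltW.
(* By greediness this compares [n.+1] with [n] applications of [Topt]; both lie within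
   [alpha ^+ n * D] of the fixed point. *)
have drift j : `|Tmu alpha g Pt mu J j - J j| <= 2 * (alpha ^+ n * D).
  rewrite greedy -(subrKA (Jstar j)); apply: le_trans (ler_normD _ _) _.
  rewrite (distrC (Jstar j)); have := JD n.+1 j; have := JD n j.
  rewrite -/J exprS -mulrA; nra.
have := iter_Tmu_drift m (mulr_ge0 (ler0n _ 2) aD) drift i.
have := JD n i; rewrite -/J; set T := iter m _ _ i => H1 H2.
have H3 : `|T - Jstar i| <= `|T - J i| + `|J i - Jstar i|.
  by rewrite -[T - Jstar i](subrKA (J i)); exact: ler_normD.
have al1' : 0 < 1 - alpha by rewrite subr_gt0.
(* The factor [1 - alpha ^+ m] of the drift bound is relaxed to the [1 + alpha ^+ m] of condition
   (b). *)
have H4 : `|T - J i| <= 2 * (1 + alpha ^+ m) * (alpha ^+ n / (1 - alpha)) * D.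
  rewrite (_ : _ * D = 2 * (1 + alpha ^+ m) * (alpha ^+ n * D) / (1 - alpha)); last by ring.
  rewrite ler_pdivlMr// mulrC (le_trans H2)//.
  have : 0 <= alpha ^+ m by rewrite exprn_ge0// ltW.
  nra.
by rewrite mulrDl (le_trans H3)// addrC lerD.
Qed.

End Contraction.

(** * Martingale series *)

Section SubSigmaAlgebra.
Context {d : measure_display} {T : measurableType d} {R : realType}.
Variable G : set (set T).
Hypothesis sG : sigma_algebra setT G.

(** Complements of the sublevel sets are the open upper rays, which generate the Borel sets. This
    bridge makes the general closure properties of measurable functions available for each [F k]. *)
Lemma FmeasP (f : T -> R) :
  Fmeas G f <-> measurable_fun setT (f : g_sigma_algebraType G -> R).
Proof.
have GE := measurable_g_measurableTypeE sG; split=> [Gf|mf r].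
  move=> _; apply: (measurability _ (RGenOInfty.measurableE R)) => //.
  move=> /= _ [_ [r ->] <-]; rewrite setTI.
  rewrite (_ : _ @^-1` _ = ~` [set x | f x <= r]); last first.
    apply/seteqP; split=> x /=; rewrite in_itv /= andbT ltNge; first by move/negP.
    by move=> /negP.
  by apply: measurableC; rewrite GE; exact: Gf.
rewrite -GE (_ : [set x | f x <= r] = setT `&` f @^-1` `]-oo, r]).
  exact: mf.
by rewrite setTI; apply/seteqP; split=> x /=; rewrite in_itv.
Qed.

Lemma Fmeas_measurable (f : T -> R) : G `<=` measurable -> Fmeas G f ->
  measurable_fun setT f.
Proof.
move=> subG /FmeasP mf _ Y mY; apply: subG.
by rewrite -(measurable_g_measurableTypeE sG); exact: mf.
Qed.

End SubSigmaAlgebra.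

(** * Orthogonality of centred variables to bounded measurable factors *)

Section ZeroConditionalMean.
Context {d : measure_display} {T : measurableType d} {R : realType}.
Variable P : probability T R.

Lemma ae_bounded_integrable (f : T -> R) (c : R) (B : set T) : measurable B ->
  measurable_fun setT f -> {ae P, forall x, `|f x| <= c} ->
  P.-integrable B (EFin \o f).
Proof.
move=> mB mf fc; apply/integrableP; split.
  exact/measurable_EFinP/measurable_funTS.
apply: le_lt_trans (_ : `|c|%:E * P B < +oo)%E.
  apply: integral_le_bound => //; first exact/measurable_EFinP/measurable_funTS.
  by apply: filterS fc => x fx _; rewrite lee_fin (le_trans fx)// ler_norm.
rewrite lte_mul_pinfty//; apply: le_lt_trans (probability_le1 P mB) _.
exact: ltry.
Qed.

Lemma bounded_integrable (f : T -> R) (c : R) (B : set T) : measurable B ->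
  measurable_fun setT f -> (forall x, `|f x| <= c) ->
  P.-integrable B (EFin \o f).
Proof. by move=> mB mf fc; apply: (ae_bounded_integrable mB mf); exact: aeW fc. Qed.

Lemma ler_norm_Rintegral (f : T -> R) (c b : R) (B : set T) : measurable B ->
  measurable_fun setT f -> (forall x, `|f x| <= b) ->
  (forall x, B x -> `|f x| <= c) ->
  `|\int[P]_(x in B) f x| <= c * fine (P B).
Proof.
move=> mB mf fb fc.
apply: le_trans (le_normr_Rintegral mB (bounded_integrable mB mf fb)) _.
rewrite -(Rintegral_cst P mB); apply: le_Rintegral => //.
- apply: (@bounded_integrable _ b) => // [|x]; last by rewrite normr_id.
  exact: measurableT_comp.
- by apply: (@bounded_integrable _ `|c|).
Qed.

Variables (G : set (set T)) (xi : T -> R) (c : R).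
Hypothesis sG : sigma_algebra setT G.
Hypothesis subG : G `<=` measurable.
Hypothesis mxi : measurable_fun setT xi.
Hypothesis xi_le : forall x, `|xi x| <= c.
(** This encodes that the conditional expectation of [xi] given [G] is 0. *)
Hypothesis xi0 : forall B, G B -> \int[P]_(x in B) xi x = 0.

(* Each induction step halves the range of [Y] by splitting [B] along the
   level set at the midpoint. *)
Lemma Rintegral_mulr_zero_mean_le (Y : T -> R) (M : R) (n : nat) :
  Fmeas G Y -> (forall x, `|Y x| <= M) ->
  forall (B : set T) (a b : R), G B -> 0 <= b ->
  (forall x, B x -> a <= Y x <= a + b * 2 ^+ n) ->
  `|\int[P]_(x in B) (xi x * Y x)| <= c * b * fine (P B).
Proof.
move=> mY YM.
have mY' := Fmeas_measurable sG subG mY.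
have bnd a x : `|xi x * (Y x - a)| <= c * (M + `|a|).
  rewrite normrM; apply: ler_pM => //.
  by apply: le_trans (ler_normB _ _) _; rewrite lerD2r.
elim: n => [|n IH] B a b GB b0 YB; have mB := subG GB.
  (* Base case: [Y] varies by at most [b] on [B]. Subtracting the constant [a] is free because [xi]
     integrates to 0 over [B], and the remaining factor is at most [b]. *)
  have -> : \int[P]_(x in B) (xi x * Y x) = \int[P]_(x in B) (xi x * (Y x - a)).
    have -> : \int[P]_(x in B) (xi x * (Y x - a))
        = \int[P]_(x in B) (xi x * Y x - xi x * a).
      by apply: eq_Rintegral => x _; rewrite mulrBr.
    have i1 := bounded_integrable mB mxi xi_le.
    rewrite RintegralB//.
    - by rewrite RintegralZr// xi0// mul0r subr0.
    - apply: (@bounded_integrable _ (c * (M + `|0|))) => //.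
        exact: measurable_funM.
      by move=> x; rewrite -{1}(subr0 (Y x)).
    - apply: (@bounded_integrable _ (c * `|a|)) => //.
        by apply: measurable_funM.
      by move=> x; rewrite normrM ler_wpM2r.
  apply: (@ler_norm_Rintegral _ _ (c * (M + `|a|))) => //.
    by apply: measurable_funM => //; apply: measurable_funB.
  move=> x Bx; rewrite normrM; apply: ler_pM => //.
  by have /andP[? ?] := YB x Bx; rewrite ger0_norm ?subr_ge0// lerBlDl -[b]mulr1.
pose q := a + b * 2 ^+ n.
pose E := [set x | Y x <= q].
have GT := measurable_g_measurableTypeE sG.
have GE : G E by exact: mY.
have mE := subG GE.
have GBE : G (B `&` E).
  by rewrite -GT; apply: measurableI; rewrite GT.
have GBC : G (B `&` ~` E).
  by rewrite -GT; apply: measurableI; [|apply: measurableC]; rewrite GT.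
have BE : B = (B `&` E) `|` (B `&` ~` E) by rewrite -setIUr setUv setIT.
have dBE : [disjoint (B `&` E) & (B `&` ~` E)].
  by apply/disj_setPS => x [[_ ?] [_ ?]].
have mBE := subG GBE; have mBC := subG GBC.
have -> : fine (P B) = fine (P (B `&` E)) + fine (P (B `&` ~` E)).
  by rewrite {1}BE measureU// ?fineD// ?fin_num_measure//; apply/disj_set2P.
rewrite {1}BE Rintegral_setU//; last first.
  rewrite -BE; apply: (@bounded_integrable _ (c * (M + `|0|))) => //.
    exact: measurable_funM.
  by move=> x; rewrite -{1}(subr0 (Y x)).
rewrite mulrDr; apply: le_trans (ler_normD _ _) _; apply: lerD.
  apply: (IH _ a) => // x [Bx Ex].
  by have /andP[-> _] := YB x Bx.
apply: (IH _ q) => // x [Bx /negP]; rewrite -ltNge => qY.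
have /andP[_ Yb] := YB x Bx; rewrite (ltW qY)/=.
by apply: le_trans Yb _; rewrite /q exprS mulrCA mulr_natl mulr2n addrA.
Qed.

(** The range of [Y] is cut into [2 ^+ n] slices whose width tends to 0. This orthogonality is what
    kills the cross terms in second moments. *)
Lemma Rintegral_mulr_zero_mean (Y : T -> R) (M : R) :
  Fmeas G Y -> (forall x, `|Y x| <= M) -> \int[P]_x (xi x * Y x) = 0.
Proof.
move=> mY YM; apply/eqP; rewrite -normr_eq0 eq_le normr_ge0 andbT.
apply/ler_addgt0Pl => e e0; rewrite addr0.
have GT : G setT by rewrite -(measurable_g_measurableTypeE sG); exact: measurableT.
pose K := 2 * `|M| * `|c| / e.
have [n Kn] : exists n, K <= 2 ^+ n.
  have [n] : exists n : nat, K < n%:R.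
    exists (Num.trunc `|K|).+1.
    by apply: le_lt_trans (ler_norm _) _; exact: truncnS_gt.
  move=> Kn; exists n; apply: le_trans (ltW Kn) _.
  by rewrite -natrX ler_nat ltnW// ltn_expl.
have p2 : 0 < 2 ^+ n :> R by rewrite exprn_gt0.
pose b := 2 * `|M| / 2 ^+ n.
have b0 : 0 <= b by rewrite /b divr_ge0 ?mulr_ge0// ltW.
have := @Rintegral_mulr_zero_mean_le Y M n mY YM setT (- `|M|) b GT b0.
rewrite probability_setT /= mulr1 => /(_ _)/le_trans; apply.
  move=> x _; rewrite /b divfK ?gt_eqF//.
  have := YM x; rewrite ler_norml => /andP[H H0]; have H1 := ler_norm M.
  by rewrite mulr_natl mulr2n addKr (le_trans H0 H1) (le_trans _ H)// lerN2.
apply: (@le_trans _ _ (`|c| * b)).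
  by rewrite ler_wpM2r// ler_norm.
rewrite /b mulrA ler_pdivrMr//.
by move: Kn; rewrite /K ler_pdivrMr// [X in _ -> X <= _]mulrC (mulrC e).
Qed.

End ZeroConditionalMean.

(** * Kolmogorov's maximal inequality by stopping *)

Section MaximalInequality.
Context {d : measure_display} {T : measurableType d} {R : realType}.
Variables (P : probability T R) (F : nat -> set (set T)).
Variables (xi : nat -> T -> R) (c : nat -> R).
Hypothesis sF : forall k, sigma_algebra setT (F k).
Hypothesis subF : forall k, F k `<=` measurable.
Hypothesis incF : forall k, F k `<=` F k.+1.
Hypothesis mxi : forall k, Fmeas (F k.+1) (xi k).
Hypothesis xi_le : forall k x, `|xi k x| <= c k.
Hypothesis xi0 : forall k B, F k B -> \int[P]_(x in B) xi k x = 0.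

(** The partial sums frozen as soon as their absolute value reaches [e]: an excursion at any time up
    to [n] is still visible at time [n]. *)
Fixpoint stopped (e : R) (n : nat) (x : T) : R :=
  if n is n'.+1 then
    stopped e n' x + (if `|stopped e n' x| < e then xi n' x else 0)
  else 0.

Lemma stopped_eq_sum e n x : `|stopped e n x| < e ->
  stopped e n x = \sum_(k < n) xi k x /\
  forall j, (j <= n)%N -> `|\sum_(k < j) xi k x| < e.
Proof.
elim: n => [|n IH] /=.
  rewrite big_ord0 => e0; split=> // j; rewrite leqn0 => /eqP ->.
  by rewrite big_ord0.
case: ifPn => [Sn|Sn]; last by rewrite addr0 (negbTE Sn).
have [-> lt_e] := IH Sn.
rewrite big_ord_recr /= => Sn1; split=> // j.
rewrite leq_eqVlt => /predU1P[->|]; last by rewrite ltnS; exact: lt_e.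
by rewrite big_ord_recr.
Qed.

Lemma Fmeas_stopped e n : Fmeas (F n) (stopped e n).
Proof.
elim: n => [|n IH]; first by apply/FmeasP => //; exact: measurable_cst.
have IH' : Fmeas (F n.+1) (stopped e n) by move=> r; apply: incF; exact: IH.
apply/FmeasP => //=; move: IH' => /FmeasP -/(_ (sF _)) mS.
apply: measurable_funD => //; apply: measurable_fun_ifT => //.
- apply: measurable_fun_ltr => //.
  by apply: measurableT_comp => //; exact: normr_measurable.
- by apply/FmeasP.
Qed.

Lemma stopped_bounded e n : exists M, forall x, `|stopped e n x| <= M.
Proof.
elim: n => [|n [M HM]]; first by exists 0 => x /=; rewrite normr0.
exists (M + `|c n|) => x /=; apply: le_trans (ler_normD _ _) _; apply: lerD => //.
case: ifPn => _; last by rewrite normr0.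
by apply: le_trans (xi_le _ _) _; exact: ler_norm.
Qed.

(** Expanding the square of one step leaves the old square, the cross term [xi n * Y] and the new
    square [Z]. Here [Y] is measurable for [F n] and bounded by [2 * e] thanks to the stopping, so
    the cross term integrates to 0, while [Z] is at most [c n ^+ 2]. *)
Lemma stopped_second_moment e n : 0 < e ->
  \int[P]_x (stopped e n x ^+ 2) <= \sum_(k < n) c k ^+ 2.
Proof.
move=> e0; elim: n => [|n IH].
  by rewrite big_ord0 /= expr0n /= Rintegral_cst// mul0r.
have [M HM] := stopped_bounded e n.
have mS := Fmeas_measurable (sF n) (@subF n) (Fmeas_stopped e n).
have mxn := Fmeas_measurable (sF n.+1) (@subF n.+1) (@mxi n).
have mA : measurable_fun setT (fun x => `|stopped e n x| < e).
  by apply: measurable_fun_ltr => //; apply: measurableT_comp.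
pose Y x := if `|stopped e n x| < e then 2 * stopped e n x else 0.
pose Z x := if `|stopped e n x| < e then xi n x ^+ 2 else 0.
have FY : Fmeas (F n) Y.
  apply/FmeasP => //; have /FmeasP -/(_ (sF n)) mSn := Fmeas_stopped e n.
  apply: measurable_fun_ifT => //.
    apply: measurable_fun_ltr => //.
    by apply: measurableT_comp => //; exact: normr_measurable.
  exact: measurable_funM.
have YM x : `|Y x| <= 2 * e.
  rewrite /Y; case: ifPn => [Se|_]; last by rewrite normr0 mulr_ge0// ltW.
  by rewrite normrM ger0_norm// ler_wpM2l// ltW.
have mY := Fmeas_measurable (sF n) (@subF n) FY.
have Zc x : 0 <= Z x <= c n ^+ 2.
  rewrite /Z; case: ifPn => _; last by rewrite lexx sqr_ge0.
  by rewrite sqr_ge0 -real_normK ?num_real// lerXn2r ?nnegrE ?(le_trans _ (xi_le n x)).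
have mZ : measurable_fun setT Z.
  by apply: measurable_fun_ifT => //; exact: measurable_funX.
have iS2 : P.-integrable setT (EFin \o (fun x => stopped e n x ^+ 2)).
  apply: (@bounded_integrable _ _ _ _ _ (M ^+ 2)) => //; first exact: measurable_funX.
  by move=> x; rewrite normrX lerXn2r ?nnegrE// (le_trans _ (HM x)).
have iZ : P.-integrable setT (EFin \o Z).
  apply: (@bounded_integrable _ _ _ _ _ (c n ^+ 2)) => // x.
  by have /andP[Z0 Z1] := Zc x; rewrite ger0_norm.
have iY : P.-integrable setT (EFin \o (fun x => xi n x * Y x)).
  apply: (@bounded_integrable _ _ _ _ _ (c n * (2 * e))) => //; first exact: measurable_funM.
  by move=> x; rewrite normrM; apply: ler_pM.
have -> : \int[P]_x (stopped e n.+1 x ^+ 2)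
    = \int[P]_x (stopped e n x ^+ 2 + xi n x * Y x + Z x).
  apply: eq_Rintegral => x _ /=; rewrite /Y /Z; case: ifPn => _.
    by rewrite sqrrD mulr_natl mulrnAr [xi n x * _]mulrC.
  by rewrite mulr0 !addr0.
rewrite RintegralD// ?RintegralD//; last first.
  by apply: eq_integrable (integrableD _ iS2 iY).
rewrite (Rintegral_mulr_zero_mean (sF n) (@subF n) mxn (@xi_le n) (@xi0 n) FY YM) addr0.
rewrite big_ord_recr /=; apply: lerD => //.
have P1 : 1 = fine (P setT) by rewrite probability_setT.
rewrite -[leRHS]mulr1 P1.
rewrite -(Rintegral_cst P measurableT); apply: le_Rintegral => //.
- by apply: (@bounded_integrable _ _ _ _ _ `|c n ^+ 2|).
- by move=> x _; case/andP: (Zc x).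
Qed.

(** By [stopped_eq_sum], a partial sum reaching [e] forces the stopped sum to have size at least [e]
    at time [n]; Chebyshev's inequality then applies to that single variable. *)
Lemma kolmogorov_maximal_inequality (e : R) n : 0 < e ->
  (P [set x | exists2 j, (j <= n)%N & (e <= `|\sum_(k < j) xi k x|)%R]
   <= ((\sum_(k < n) c k ^+ 2) / e ^+ 2)%:E)%E.
Proof.
move=> e0; pose E := [set x | e <= `|stopped e n x|].
have mS := Fmeas_measurable (sF n) (@subF n) (Fmeas_stopped e n).
have mE : measurable E.
  by rewrite -[E]setTI; apply: measurable_fun_le => //; apply: measurableT_comp.
have subE : [set x | exists2 j, (j <= n)%N & (e <= `|\sum_(k < j) xi k x|)%R] `<=` E.
  move=> x [j jn ej]; rewrite /E /= leNgt; apply/negP => /stopped_eq_sum[_ /(_ j jn)].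
  by rewrite ltNge ej.
have mX : measurable [set x | exists2 j, (j <= n)%N & (e <= `|\sum_(k < j) xi k x|)%R].
  rewrite (_ : mkset _ = \bigcup_(j in [set j | (j <= n)%N])
      [set x | (e <= `|\sum_(k < j) xi k x|)%R]); last first.
    by apply/seteqP; split=> [x [j jn ej]|x [j jn ej]]; exists j.
  apply: bigcup_measurable => j _; rewrite -[X in measurable X]setTI.
  apply: measurable_fun_le => //; apply: measurableT_comp => //.
  apply: measurable_sum => k.
  have := Fmeas_measurable (sF k.+1) (@subF k.+1) (@mxi k); exact.
have /le_trans : (P [set x | exists2 j, (j <= n)%N & (e <= `|\sum_(k < j) xi k x|)%R] <= P E)%E
  by apply: le_measure => //; rewrite inE.
apply.
rewrite -(@fineK _ (P E)) ?fin_num_measure// lee_fin ler_pdivlMr ?exprn_gt0//.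
apply: le_trans (stopped_second_moment n e0).
have [M HM] := stopped_bounded e n.
rewrite mulrC -(Rintegral_cst P mE) Rintegral_mkcond.
apply: le_Rintegral => //.
- apply: (@bounded_integrable _ _ _ _ _ (e ^+ 2)) => //.
    by apply/(measurable_restrictT _ mE); exact: measurable_cst.
  by move=> x; rewrite patchE; case: ifPn => _; rewrite ?normr0 ?sqr_ge0// ger0_norm ?sqr_ge0.
- apply: (@bounded_integrable _ _ _ _ _ (M ^+ 2)) => //; first exact: measurable_funX.
  by move=> x; rewrite normrX lerXn2r ?nnegrE// (le_trans _ (HM x)).
- move=> x _; rewrite patchE; case: ifPn => [|_]; last exact: sqr_ge0.
  rewrite inE => Ex; rewrite -[leRHS]real_normK ?num_real// lerXn2r ?nnegrE//.
  exact: ltW.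
Qed.

End MaximalInequality.

(** * Almost sure convergence from square-summable bounds *)

Section MartingaleConvergence.
Context {d : measure_display} {T : measurableType d} {R : realType}.
Variables (P : probability T R) (F : nat -> set (set T)).
Hypothesis sF : forall k, sigma_algebra setT (F k).
Hypothesis subF : forall k, F k `<=` measurable.
Hypothesis incF : forall k, F k `<=` F k.+1.

(** The maximal inequality for the filtration shifted by [N] bounds every finite window uniformly,
    and continuity from below removes the horizon. *)
Lemma oscillation_le (xi : nat -> T -> R) (c : nat -> R) (Q e : R) (N : nat) :
  (forall k, Fmeas (F k.+1) (xi k)) -> (forall k x, `|xi k x| <= c k) ->
  (forall k B, F k B -> \int[P]_(x in B) xi k x = 0) ->
  (forall n, \sum_(k < n) c k ^+ 2 <= Q) -> 0 < e ->
  measurable [set x | exists j, e <= `|\sum_(k < j) xi (N + k)%N x|] /\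
  (P [set x | exists j, (e <= `|\sum_(k < j) xi (N + k)%N x|)%R]
   <= ((Q - \sum_(k < N) c k ^+ 2) / e ^+ 2)%:E)%E.
Proof.
move=> mxi xi_le xi0 cQ e0.
pose B j := [set x | e <= `|\sum_(k < j) xi (N + k)%N x|].
have mB j : measurable (B j).
  rewrite -[B j]setTI; apply: measurable_fun_le => //; apply: measurableT_comp => //.
  apply: measurable_sum => k.
  have := Fmeas_measurable (sF (N + k).+1) (@subF (N + k).+1) (@mxi (N + k)%N); exact.
pose A n := [set x | exists2 j, (j <= n)%N & e <= `|\sum_(k < j) xi (N + k)%N x|].
have mA n : measurable (A n).
  rewrite (_ : A n = \bigcup_(j in [set j | (j <= n)%N]) B j).
    by apply: bigcup_measurable => j _; exact: mB.
  by apply/seteqP; split=> [x [j jn ej]|x [j jn ej]]; exists j.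
have -> : [set x | exists j, e <= `|\sum_(k < j) xi (N + k)%N x|] = \bigcup_n A n.
  apply/seteqP; split=> [x [j ej]|x [n _ [j _ ej]]]; last by exists j.
  by exists j => //; exists j.
have mU : measurable (\bigcup_n A n) by exact: bigcupT_measurable.
have ndA : nondecreasing_seq A.
  move=> m n mn; apply/subsetPset => x [j jm ej]; exists j => //.
  exact: leq_trans jm mn.
split => //.
have cv := nondecreasing_cvg_mu (mu := P) mA mU ndA.
rewrite -(cvg_lim _ cv)//; apply: lime_le; first by apply/cvg_ex; eexists; exact: cv.
apply: nearW => n /=.
have := @kolmogorov_maximal_inequality _ _ _ P (fun k => F (N + k)%N) (fun k => xi (N + k)%N)
  (fun k => c (N + k)%N) (fun k => sF _) (fun k => @subF _).
move=> /(_ _ _ _ _ e n e0)/le_trans; apply.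
- by move=> k; rewrite addnS; exact: incF.
- by move=> k; rewrite addnS; exact: mxi.
- by move=> k; exact: xi_le.
- by move=> k; exact: xi0.
rewrite lee_fin ler_pM2r ?invr_gt0 ?exprn_gt0// lerBrDr addrC.
by have := cQ (N + n)%N; rewrite big_split_ord.
Qed.

(** Where the series is not Cauchy, some oscillation level [e q] is reached after every start [N].
    For fixed [q] that event has probability at most the tail of the sum of [c k ^+ 2] over
    [e q ^+ 2], which tends to 0 with [N]. *)
Lemma bounded_martingale_series_cvg (xi : nat -> T -> R) (c : nat -> R) :
  (forall k, Fmeas (F k.+1) (xi k)) -> (forall k x, `|xi k x| <= c k) ->
  (forall k B, F k B -> \int[P]_(x in B) xi k x = 0) ->
  cvg ((fun n => \sum_(k < n) c k ^+ 2) @ \oo) ->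
  {ae P, forall x, cvg ((fun n => \sum_(k < n) xi k x) @ \oo)}.
Proof.
move=> mxi xi_le xi0 c2.
pose Q : R := lim ((fun n => \sum_(k < n) c k ^+ 2) @ \oo).
have ndc : nondecreasing_seq (fun n => \sum_(k < n) c k ^+ 2).
  apply/nondecreasing_seqP => n.
  by rewrite big_ord_recr /= lerDl sqr_ge0.
have cQ n : \sum_(k < n) c k ^+ 2 <= Q by exact: nondecreasing_cvgn_le.
pose e (q : nat) : R := q.+1%:R^-1.
have e0 q : 0 < e q by rewrite invr_gt0.
pose E N q := [set x | exists j, e q <= `|\sum_(k < j) xi (N + k)%N x|].
have osc N q := oscillation_le N mxi xi_le xi0 cQ (e0 q).
have neg q : P.-negligible (\bigcap_N E N q).
  have mI : measurable (\bigcap_N E N q).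
    by apply: bigcapT_measurable => N; have [] := osc N q.
  apply/negligibleP => //; apply/eqP; rewrite -measure_le0.
  apply/lee_addgt0Pr => z z0; rewrite add0e.
  have t0 : 0 < z * e q ^+ 2 by rewrite mulr_gt0// exprn_gt0.
  have /cvgrPdist_le /(_ _ t0) [N _ /(_ N (leqnn N)) HN] := c2.
  have [mE PE] := osc N q.
  have /le_trans : (P (\bigcap_N E N q) <= P (E N q))%E.
    by apply: le_measure; rewrite ?inE//; exact: bigcap_inf.
  apply.
  apply: le_trans PE _; rewrite lee_fin ler_pdivrMr ?exprn_gt0//.
  exact: le_trans (ler_norm _) HN.
apply: negligibleS (negligible_bigcup neg) => x /= ncv.
apply: contrapT => bad; apply: ncv.
apply/cauchy_cvgP/cauchy_exP => z z0.
have [q qz] : exists q, e q < z.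
  exists (Num.trunc z^-1); rewrite /e invf_plt ?posrE//.
  exact: truncnS_gt.
have /existsNP[N /not_implyP[_ /forallNP HN]] : ~ forall N, setT N -> E N q x.
  by move=> h; apply: bad; exists q.
exists (\sum_(k < N) xi k x); exists N => // n /= Nn.
have [r ->] : exists r, n = (N + r)%N by exists (n - N)%N; rewrite subnKC.
have /negP := HN r; rewrite -ltNge => lt_e.
rewrite -ball_normE /=; apply: lt_trans qz; apply: le_lt_trans lt_e.
by rewrite distrC big_split_ord /= addrAC subrr add0r.
Qed.

(** Cutting [xi k] to 0 where it exceeds its bound turns the almost sure bound into a sure one. The
    cut keeps adaptedness and changes [xi k] only on a null set, so the integrals still vanish. *)
Lemma martingale_series_cvg (xi : nat -> T -> R) (c : nat -> R) :
  (forall k, Fmeas (F k.+1) (xi k)) ->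
  (forall k, {ae P, forall x, `|xi k x| <= c k}) ->
  (forall k B, F k B -> (\int[P]_(x in B) (xi k x)%:E = 0)%E) ->
  cvg ((fun n => \sum_(k < n) c k ^+ 2) @ \oo) ->
  {ae P, forall x, cvg ((fun n => \sum_(k < n) xi k x) @ \oo)}.
Proof.
move=> mxi xi_le xi0 c2.
pose zeta k x := if `|xi k x| <= `|c k| then xi k x else 0.
have mzeta k : Fmeas (F k.+1) (zeta k).
  apply/FmeasP => //; have /FmeasP -/(_ (sF k.+1)) mk := mxi k.
  apply: measurable_fun_ifT => //; apply: measurable_fun_ler => //.
  by apply: measurableT_comp => //; exact: normr_measurable.
have zetaE : {ae P, forall x, forall k, xi k x = zeta k x}.
  apply/ae_foralln => k; apply: filterS (xi_le k) => x xc.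
  by rewrite /zeta (le_trans xc (ler_norm _)).
have zeta_cvg : {ae P, forall x, cvg ((fun n => \sum_(k < n) zeta k x) @ \oo)}.
  apply: (@bounded_martingale_series_cvg zeta (fun k => `|c k|)) => //.
  - by move=> k x; rewrite /zeta; case: ifPn => // _; rewrite normr0.
  - move=> k B FB.
    rewrite /Rintegral (_ : integral _ _ _ = 0%E)// -[RHS](xi0 _ _ FB).
    apply: ae_eq_integral.
    + exact: subF FB.
    + apply/measurable_EFinP/measurable_funTS.
      by have := Fmeas_measurable (sF k.+1) (@subF k.+1) (mzeta k).
    + apply/measurable_EFinP/measurable_funTS.
      by have := Fmeas_measurable (sF k.+1) (@subF k.+1) (mxi k).
    + by apply: filterS zetaE => x /(_ k) xz _ /=; rewrite xz.
  - by under eq_fun do under eq_bigr do rewrite real_normK ?num_real//.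
apply: filterS2 zetaE zeta_cvg => x xz.
by under eq_fun do under eq_bigr do rewrite -xz.
Qed.

End MartingaleConvergence.

(** * The algorithm *)

Section MeasurableOperators.
Context {d : measure_display} {T : measurableType d} {R : realType}.
Variables (S A : finType) (a0 : A) (alpha : R).
Variables (g : S -> A -> R) (Pt : S -> A -> S -> R).

Lemma measurable_fun_finite (I : finType) (f : T -> I) (h : I -> R) :
  (forall i, measurable [set x | f x = i]) -> measurable_fun setT (fun x => h (f x)).
Proof.
move=> mf _ Y mY; rewrite setTI.
rewrite (_ : _ @^-1` _ = \bigcup_(i in [set i | Y (h i)]) [set x | f x = i]).
  by apply: fin_bigcup_measurable => [|i _]; [exact: finite_finset|exact: mf].
by apply/seteqP; split=> [x Yx|x [i Yi fi]]; [exists (f x)|rewrite /preimage /= fi].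
Qed.

Lemma measurable_Topt (J : T -> S -> R) :
  (forall i, measurable_fun setT (fun x => J x i)) ->
  forall i, measurable_fun setT (fun x => Topt a0 alpha g Pt (J x) i).
Proof.
move=> mJ i.
have mQ u : measurable_fun setT
    (fun x => g i u + alpha * \sum_(j : S) Pt i u j * J x j).
  apply: measurable_funD => //; apply: measurable_funM => //.
  by apply: measurable_sum => j; exact: measurable_funM.
rewrite /Topt; elim: (index_enum A) => [|u s IH].
  by under eq_fun do rewrite big_nil; exact: mQ.
under eq_fun do rewrite big_cons.
exact: (measurable_minr (mQ u) IH).
Qed.

Lemma measurable_iter_Topt n (J : T -> S -> R) :
  (forall i, measurable_fun setT (fun x => J x i)) ->
  forall i, measurable_fun setT (fun x => iter n (Topt a0 alpha g Pt) (J x) i).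
Proof. by move=> mJ; elim: n => [|n IH] //= i; exact: measurable_Topt. Qed.

Lemma measurable_iter_Tmu n (mu : T -> {ffun S -> A}) (J : T -> S -> R) :
  (forall pi, measurable [set x | mu x = pi]) ->
  (forall i, measurable_fun setT (fun x => J x i)) ->
  forall i, measurable_fun setT (fun x => iter n (Tmu alpha g Pt (mu x)) (J x) i).
Proof.
move=> mmu mJ; elim: n => [|n IH] //= i; rewrite /Tmu.
apply: measurable_funD.
  exact: (measurable_fun_finite (fun pi : {ffun S -> A} => g i (pi i)) mmu).
apply: measurable_funM => //; apply: measurable_sum => j.
apply: measurable_funM; last exact: IH.
exact: (measurable_fun_finite (fun pi : {ffun S -> A} => Pt i (pi i) j) mmu).
Qed.

Lemma measurable_visited (X : T -> nat -> S) (L : T -> nat) i :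
  (forall t s, measurable [set x | X x t = s]) ->
  (forall n, measurable [set x | L x = n]) ->
  measurable [set x | i \in visited (X x) (L x)].
Proof.
move=> mX mL.
rewrite (_ : mkset _ = \bigcup_n ([set x | L x = n] `&`
    \bigcup_(t in [set t | (t <= n)%N]) [set x | X x t = i])); last first.
  apply/seteqP; split=> x /=.
    rewrite inE => /existsP[t /eqP Xt]; exists (L x) => //; split=> //.
    by exists t => //=; rewrite -ltnS.
  move=> [n _ [/= Ln [t /= tn Xt]]]; rewrite inE; apply/existsP.
  have tL : (t < (L x).+1)%N by rewrite Ln ltnS.
  by exists (Ordinal tL); apply/eqP.
apply: bigcupT_measurable => n; apply: measurableI => //.
exact: bigcup_measurable.
Qed.

End MeasurableOperators.

(** The law of the trajectory is given separately on each event where the policy takes a fixed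
    value; summing over the finitely many values removes that restriction. *)
Lemma probability_partition_independent (d : measure_display)
  (T : measurableType d) (R : realType) (P : probability T R) (I : finType)
  (f : T -> I) (B E : set T) (r : R) :
  measurable B -> measurable E -> (forall i, measurable [set x | f x = i]) ->
  (forall i, P (B `&` [set x | f x = i] `&` E)
             = (P (B `&` [set x | f x = i]) * r%:E)%E) ->
  P (B `&` E) = (P B * r%:E)%E.
Proof.
move=> mB mE mf fE.
have split_f D : measurable D ->
    P D = (\sum_(i \in [set: I]) P (D `&` [set x | f x = i]))%E.
  move=> mD; rewrite -measure_fin_bigcup//.
  - rewrite -setI_bigcupr (_ : \bigcup_(i in _) _ = setT) ?setIT//.
    by apply/seteqP; split=> // x _; exists (f x).
  - exact: finite_finset.
  - apply/trivIsetP => i j _ _ ij; rewrite -subset0 => x [[_ fi] [_ fj]].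
    by case/eqP: ij; rewrite -fi -fj.
  - by move=> i _; exact: measurableI.
rewrite (split_f _ (measurableI _ _ mB mE)) (split_f _ mB).
rewrite ge0_mule_fsuml// ; apply: eq_fsbigr => i _.
by rewrite setIAC fE.
Qed.

Lemma sum_scaled_sqr_cvg (R : realType) (gamma : nat -> R) (K : R) :
  cvg ((fun n => \sum_(k < n) gamma k ^+ 2) @ \oo) ->
  cvg ((fun n => \sum_(k < n) (gamma k * K) ^+ 2) @ \oo).
Proof.
move=> gc.
rewrite (_ : (fun n => _) = (fun n => (\sum_(k < n) gamma k ^+ 2) * K ^+ 2)).
  by apply: is_cvgMl.
by apply/funext => n; rewrite mulr_suml; apply: eq_bigr => k _; rewrite exprMn.
Qed.

(** A convergent series has bounded partial sums, so the weighted sum of the [u k] stays within a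
    constant of [r] times the sum of the [gamma k]. *)
Lemma sum_recentered_cvgy (R : realType) (gamma u : nat -> R) (r : R) :
  0 < r -> (fun n => \sum_(k < n) gamma k) @ \oo --> +oo ->
  cvg ((fun n => \sum_(k < n) gamma k * (u k - r)) @ \oo) ->
  (fun n => \sum_(k < n) gamma k * u k) @ \oo --> +oo.
Proof.
move=> r0 /cvgryPge gy /cvg_seq_bounded[M [_ HM]].
apply/cvgryPge => K.
apply: filterS (gy ((K + (M + 1)) / r)) => n; rewrite ler_pdivrMr// => Kn.
have M1 : M < M + 1 by rewrite ltrDl.
have := HM _ M1 n Logic.I.
rewrite /= ler_norml => /andP[+ _].
under eq_bigr do rewrite mulrBr.
by rewrite sumrB -mulr_suml; lra.
Qed.

(** * Random series weighted by the stepsizes *)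

Section StepsizeSeries.
Context {d : measure_display} {T : measurableType d} {R : realType}.
Variables (P : probability T R) (F : nat -> set (set T)) (gamma : nat -> R).
Hypothesis sF : forall k, sigma_algebra setT (F k).
Hypothesis subF : forall k, F k `<=` measurable.
Hypothesis incF : forall k, F k `<=` F k.+1.
Hypothesis gamma_ge0 : forall k, 0 <= gamma k.
Hypothesis gamma2 : cvg ((fun n => \sum_(k < n) gamma k ^+ 2) @ \oo).

(** A weighted form of the conditional Borel-Cantelli lemma: [E k] has conditional probability [r]
    given [F k], so the recentred indicators are martingale differences bounded by [1 + r]. *)
Lemma weighted_events_cvgy (E : nat -> set T) (r : R) : 0 < r ->
  (fun n => \sum_(k < n) gamma k) @ \oo --> +oo ->
  (forall k, F k.+1 (E k)) ->
  (forall k B, F k B -> P (B `&` E k) = (P B * r%:E)%E) ->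
  {ae P, forall x, (fun n => \sum_(k < n) gamma k * \1_(E k) x) @ \oo --> +oo}.
Proof.
move=> r0 gy FE PE.
have cv : {ae P, forall x,
    cvg ((fun n => \sum_(k < n) gamma k * (\1_(E k) x - r)) @ \oo)}.
  apply: (@martingale_series_cvg _ _ _ P F sF subF incF
      (fun k x => gamma k * (\1_(E k) x - r)) (fun k => gamma k * (1 + r))).
  - move=> k; apply/FmeasP => //; apply: measurable_funM => //.
    apply: measurable_funB => //; apply: measurable_indic.
    by rewrite measurable_g_measurableTypeE.
  - move=> k; apply: aeW => x; rewrite normrM (ger0_norm (gamma_ge0 k)).
    apply: ler_wpM2l => //; apply: le_trans (ler_normB _ _) _.
    rewrite (gtr0_norm r0) lerD2r indicE.
    by case: (_ \in _); rewrite ?normr1 ?normr0.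
  - move=> k B FB; have mB := subF FB; have mE := subF (FE k).
    have iI : P.-integrable B (EFin \o \1_(E k)).
      apply: (@bounded_integrable _ _ _ _ _ 1) => // x.
      by rewrite indicE; case: (_ \in _); rewrite ?normr1 ?normr0.
    have ir : P.-integrable B (EFin \o cst r) by apply: (@bounded_integrable _ _ _ _ _ `|r|).
    have iB := integrableB mB iI ir.
    under eq_integral do rewrite EFinM EFinB.
    rewrite integralZl// integralB// integral_indic// integral_cst//.
    rewrite [X in (_ * (X - _))%E](_ : _ = (r%:E * P B)%E); last first.
      by rewrite setIC muleC; exact: PE.
    by rewrite subee ?mule0// fin_numM// fin_num_measure.
  - exact: sum_scaled_sqr_cvg.
apply: filterS cv => x.
exact: (@sum_recentered_cvgy _ gamma (fun k => \1_(E k) x) r r0 gy).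
Qed.

(** Integrating the masked noise over [B] amounts to integrating [w k] over the intersection of [B]
    with [D k], so a zero mean given a visit makes the masked noise a martingale difference. *)
Lemma weighted_noise_cvg (w : nat -> T -> R) (D : nat -> set T) (C : R) :
  (forall k, measurable_fun setT (w k)) ->
  (forall k, F k.+1 (D k)) ->
  (forall k, Fmeas (F k.+1) (w k \_ (D k))) ->
  (forall k B, F k B -> (\int[P]_(x in B `&` D k) (w k x)%:E = 0)%E) ->
  (forall k, {ae P, forall x, `|w k x| <= C}) ->
  {ae P, forall x, cvg ((fun n => \sum_(k < n) gamma k * (w k \_ (D k)) x) @ \oo)}.
Proof.
move=> mw FD mwD w0 wC.
apply: (@martingale_series_cvg _ _ _ P F sF subF incF
    (fun k x => gamma k * (w k \_ (D k)) x) (fun k => gamma k * C)).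
- move=> k; apply/FmeasP => //; apply: measurable_funM => //.
  by have /FmeasP -/(_ (sF k.+1)) := mwD k.
- move=> k; apply: filterS (wC k) => x wx.
  rewrite normrM (ger0_norm (gamma_ge0 k)) ler_wpM2l// patchE.
  by case: ifPn => // _; rewrite normr0 (le_trans _ wx).
- move=> k B FB; have mB := subF FB; have mD := subF (FD k).
  have mwk := Fmeas_measurable (sF k.+1) (@subF k.+1) (mwD k).
  have iw : P.-integrable B (EFin \o (w k \_ (D k))).
    apply: (@ae_bounded_integrable _ _ _ _ _ `|C|) => //.
    apply: filterS (wC k) => x wx; rewrite patchE.
    by case: ifPn => // _; rewrite ?normr0// (le_trans wx)// ler_norm.
  under eq_integral do rewrite EFinM.
  rewrite integralZl// (_ : integral _ _ _ = 0%E) ?mule0//.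
  rewrite -[RHS](w0 k B FB) [RHS]integral_mkcondr.
  by apply: eq_integral => x _; rewrite /= !patchE; case: ifP.
- exact: sum_scaled_sqr_cvg.
Qed.

End StepsizeSeries.

(** * Convergence along almost every trajectory *)

Theorem theorem1
  (R : realType) (S A : finType) (a0 : A)
  (alpha : R) (g : S -> A -> R) (Pt : S -> A -> S -> R)
  (m H : nat) (V0 : S -> R) (gamma : nat -> R) (p : S -> R) (C : R)
  (d : measure_display) (Omega : measurableType d) (P : probability Omega R)
  (F : nat -> set (set Omega))
  (V : nat -> Omega -> S -> R)
  (mu : nat -> Omega -> {ffun S -> A})   (* mu k = mu_{k+1} *)
  (X : nat -> Omega -> nat -> S)          (* trajectory of iteration k *)
  (L : nat -> Omega -> nat)               (* its (random) length *)
  (w : nat -> S -> Omega -> R) :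
  (* MDP *)
  0 < alpha < 1 ->
  (forall i u, 0 <= g i u <= 1) ->
  (forall i u j, 0 <= Pt i u j) ->
  (forall i u, \sum_(j : S) Pt i u j = 1) ->
  (* parameters *)
  (1 <= m)%N -> (1 <= H)%N ->
  (forall k, 0 < gamma k <= 1) ->
  (* (a) initial distribution p with full support *)
  (forall i, 0 < p i) -> \sum_(i : S) p i = 1 ->
  (* (b) *)
  alpha ^+ H.-1 + 2 * (1 + alpha ^+ m) * (alpha ^+ H.-1 / (1 - alpha)) < 1 ->
  (* (c) *)
  (fun n => \sum_(k < n) gamma k) @ \oo --> +oo ->
  cvg ((fun n => \sum_(k < n) gamma k ^+ 2) @ \oo) ->
  (* filtration: F k = history up to the start of iteration k *)
  (forall k, sigma_algebra setT (F k)) ->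
  (forall k, F k `<=` measurable) ->
  (forall k, F k `<=` F k.+1) ->
  (* adaptedness *)
  (forall k i, Fmeas (F k) (fun om => V k om i)) ->
  (forall k (pi : {ffun S -> A}), F k [set om | mu k om = pi]) ->
  (forall k t s, F k.+1 [set om | X k om t = s]) ->
  (forall k n, F k.+1 [set om | L k om = n]) ->
  (forall k i, measurable_fun setT (w k i)) ->
  (* greedy policy: T_{mu_{k+1}} T^{H-1} V_k = T^H V_k *)
  (forall k om, Tmu alpha g Pt (mu k om) (iter H.-1 (Topt a0 alpha g Pt) (V k om))
                = iter H (Topt a0 alpha g Pt) (V k om)) ->
  (* trajectory: Markov chain under mu_{k+1}, initial law p, given F k *)
  (forall k (B : set Omega) (pi : {ffun S -> A}) (t : nat) (path : nat -> S),
     F k B ->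
     P (B `&` [set om | mu k om = pi] `&`
        [set om | forall s : 'I_t.+1, X k om s = path s])
     = (P (B `&` [set om | mu k om = pi]) *
        (p (path 0%N) * \prod_(s < t) Pt (path s) (pi (path s)) (path s.+1))%:E)%E) ->
  (* noise: E[w_k(i) | F_k, i in D_k] = 0 and |w_k(i)| <= C a.s. *)
  (forall k i (B : set Omega), F k B ->
     (\int[P]_(om in B `&` [set om | i \in visited (X k om) (L k om)])
        (w k i om)%:E = 0)%E) ->
  (forall k i, {ae P, forall om, `|w k i om| <= C}) ->
  (* the algorithm *)
  (forall om, V 0%N om = V0) ->
  (forall k om i, V k.+1 om i =
     if i \in visited (X k om) (L k om)
     then (1 - gamma k) * V k om i
          + gamma k * (iter m (Tmu alpha g Pt (mu k om))
                         (iter H.-1 (Topt a0 alpha g Pt) (V k om)) i + w k i om)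
     else V k om i) ->
  (* conclusion: V_k -> J^* almost surely *)
  forall Jstar : S -> R, Topt a0 alpha g Pt Jstar = Jstar ->
  {ae P, forall om, forall i, (fun k => V k om i) @ \oo --> (Jstar i : R^o)}.

Proof.
move=> alpha01 _ Pt0 Pt1 _ H1 gamma01 p0 _ hb gy g2 sF subF incF FV Fmu FX FL mw
  greedy traj w0 wC _ VS Jstar Jfix.
have gamma0 k : 0 <= gamma k by case/andP: (gamma01 k) => /ltW.
pose D k i := [set om | i \in visited (X k om) (L k om)].
pose roll k om := iter m (Tmu alpha g Pt (mu k om))
  (iter H.-1 (Topt a0 alpha g Pt) (V k om)).
have FD k i : F k.+1 (D k i).
  rewrite -(measurable_g_measurableTypeE (sF k.+1)).
  by apply: measurable_visited => *; rewrite measurable_g_measurableTypeE.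
have mF k (f : Omega -> R) : Fmeas (F k) f ->
    measurable_fun setT (f : g_sigma_algebraType (F k.+1) -> R).
  by move=> Ff; apply/FmeasP => // r; apply: incF; exact: Ff.
have wDE k i om : (w k i \_ (D k i)) om
    = if i \in visited (X k om) (L k om) then w k i om else 0.
  rewrite patchE; case: (boolP (i \in _)) => vi; first by rewrite mem_set.
  by rewrite memNset//; exact/negP.
(* Adaptedness of the masked noise is recovered from the algorithm: on a visit, the update is solved
   for [w k i] by dividing by [gamma k > 0], which expresses it through [V k.+1], [V k] and the
   rollout. *)
have FwD k i : Fmeas (F k.+1) (w k i \_ (D k i)).
  apply/FmeasP => //.
  rewrite (_ : _ \_ _ = (fun om => if i \in visited (X k om) (L k om)
    then (gamma k)^-1 * (V k.+1 om i - (1 - gamma k) * V k om i) - roll k om i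
    else 0)); last first.
    apply/funext => om; rewrite wDE; case: ifPn => // vi; rewrite VS vi.
    have gk : gamma k != 0 by rewrite gt_eqF//; case/andP: (gamma01 k).
    by rewrite -/(roll k om); move: (roll k om i) => z; field.
  apply: measurable_fun_ifT => //.
    apply: (measurable_fun_bool true); rewrite setTI.
    rewrite (_ : _ @^-1` _ = D k i) ?measurable_g_measurableTypeE//.
  have mVk j : measurable_fun setT ((fun om => V k om j) : g_sigma_algebraType (F k.+1) -> R).
    exact: mF.
  apply: measurable_funB.
    apply: measurable_funM => //; apply: measurable_funB.
      by apply/FmeasP.
    exact: measurable_funM.
  apply: measurable_iter_Tmu => [pi|].
    by rewrite measurable_g_measurableTypeE//; apply: incF.
  exact: measurable_iter_Topt.
have noise : {ae P, forall om, forall i,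
    cvg ((fun n => \sum_(k < n) gamma k * (w k i \_ (D k i)) om) @ \oo)}.
  apply: filter_forall => i.
  apply: (@weighted_noise_cvg _ _ _ P F gamma sF subF incF gamma0 g2
    (fun k => w k i) (fun k => D k i) C) => //.
  by move=> k B FB; exact: w0.
(* Only visits at time 0 are counted: given the history their probability is exactly [p i], which is
   positive by (a). *)
pose E k i := [set om | X k om 0%N = i].
have PE k i B : F k B -> P (B `&` E k i) = (P B * (p i)%:E)%E.
  move=> FB; apply: (@probability_partition_independent _ _ _ P _ (mu k)).
  - exact: subF FB.
  - exact: subF (FX k 0%N i).
  - by move=> pi; exact: subF (Fmu k pi).
  (* With [t = 0] the path consists of the initial state alone and the product of transition
     probabilities is empty. *)
  - move=> pi; have := traj k B pi 0%N (fun=> i) FB.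
    rewrite big_ord0 mulr1 => <-; congr (P (_ `&` _)).
    by apply/seteqP; split=> om /= Xi; [move=> s; rewrite ord1|exact: (Xi ord0)].
have visits : {ae P, forall om, forall i,
    (fun n => \sum_(k < n) gamma k * \1_(E k i) om) @ \oo --> +oo}.
  apply: filter_forall => i.
  apply: (@weighted_events_cvgy _ _ _ P F gamma sF subF incF gamma0 g2
    (fun k => E k i) (p i)) => //.
  - by move=> k; exact: FX.
  - by move=> k B; exact: PE.
apply: filterS2 noise visits => om noise visits i.
(* A zero stepsize off [D k] merges the two branches of the update into one recursion. *)
pose a k i := if i \in visited (X k om) (L k om) then gamma k else 0.
pose b := alpha ^+ H.-1 + 2 * (1 + alpha ^+ m) * (alpha ^+ H.-1 / (1 - alpha)).
have x0 := @perturbed_averaging_cvg0 R S a (fun k i => V k om i - Jstar i)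
  (fun k i => roll k om i - Jstar i) (fun k i => gamma k * (w k i \_ (D k i)) om) b.
rewrite (_ : (fun k => V k om i) = (fun k => (V k om i - Jstar i) + Jstar i)); last first.
  by apply/funext => k; rewrite subrK.
rewrite -[X in _ --> X]add0r; apply: cvgD; last exact: cvg_cst.
apply: x0 => //.
- apply/andP; split=> //; have /andP[al0 al1] := alpha01.
  have aH : 0 <= alpha ^+ H.-1 by rewrite exprn_ge0// ltW.
  rewrite /b addr_ge0// !mulr_ge0//.
    by rewrite addr_ge0// exprn_ge0// ltW.
  by rewrite invr_ge0 subr_ge0 ltW.
- by move=> k j; rewrite /a; case: ifP => _; [case/andP: (gamma01 k) => /ltW -> ->|rewrite lexx ler01].
(* The initial state always belongs to the visited set, so [a k j] dominates [gamma k] times the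
   indicator of [E k j]. *)
- move=> j; apply: ger_cvgy (visits j); apply: nearW => n.
  apply: ler_sum => k _; rewrite indicE /a.
  case: (boolP (om \in E k j)) => [|_]; last by rewrite mulr0; case: ifP.
  rewrite inE /E /= mulr1 => Xj; rewrite ifT// inE; apply/existsP.
  by exists ord0; apply/eqP.
- move=> k j; rewrite VS wDE /a -/(roll k om).
  by case: ifP => _; ring.
- move=> k M xM j; apply: (lookahead_rollout_contract alpha01 Pt0 Pt1) => //.
  by rewrite greedy prednK.
Qed.
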